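(* If $E\in\mathfrak q$ is nilpotent (i.e. $\operatorname{ad}(E)$ is a nilpotent endomorphism of $\mathfrak g$), then $\operatorname{ad}(E)^3=0$ on $\mathfrak g$.
   Context: Let $l\ge 3$. Here $SO(p,q)$ denotes the identity component of the special orthogonal group of signature $(p,q)$. Let $G=SO(2,l-1)$ act on $\mathbb R^{2,l-1}$ (two positive and $l-1$ negative directions), let $H=SO(1,l-1)\subset G$ be the stabilizer of a vector of square norm $+1$, and let $\mathfrak g,\mathfrak h$ be their Lie algebras. Let $\sigma$ be the involutive automorphism of $\mathfrak g$ whose $+1$-eigenspace is $\mathfrak h$, and let $\mathfrak q$ be its $-1$-eigenspace, so that $\mathfrak g=\mathfrak h\oplus\mathfrak q$. *)

(* Defs.v *)
From HB Require Import structures.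
From mathcomp Require Import all_boot all_order all_algebra.
From mathcomp Require Import all_classical all_reals all_analysis.
Import Order.TTheory GRing.Theory Num.Theory.
Import numFieldNormedType.Exports.

Set Implicit Arguments.
Unset Strict Implicit.
Unset Printing Implicit Defensive.

Local Open Scope classical_set_scope.
Local Open Scope ring_scope.

Definition signature_mx (R : realType) (p q : nat) : 'M[R]_(p + q) :=
  block_mx 1%:M 0 0 (- 1%:M).

Definition pseudo_sqnorm (R : realType) (p q : nat) (v : 'cV[R]_(p + q)) : R :=
  (v^T *m signature_mx R p q *m v) 0 0.

Definition special_pseudo_orthogonal (R : realType) (p q : nat) :
    set 'M[R]_(p + q) :=
  [set g | g^T *m signature_mx R p q *m g = signature_mx R p q /\ \det g = 1].
Arguments special_pseudo_orthogonal : clear implicits.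

(* For p, q > 0 the group of isometries of determinant 1 is not connected:
   SO(p, q) stands for its identity component. *)
Definition SO (R : realType) (p q : nat) : set 'M[R]_(p + q) :=
  connected_component (special_pseudo_orthogonal R p q) 1%:M.
Arguments SO : clear implicits.

Definition stabilizer (R : realType) (n : nat) (G : set 'M[R]_n)
    (v : 'cV[R]_n) : set 'M[R]_n :=
  [set g | G g /\ g *m v = v].

(* The Lie algebra of a closed matrix group, realized as its tangent space at
   the identity: the velocities at 0 of the differentiable curves in G that
   pass through the identity at time 0. *)
Definition lie_algebra (R : realType) (n : nat) (G : set 'M[R]_n) :
    set 'M[R]_n :=
  [set X | exists c : R -> 'M[R]_n,
     [/\ forall t : R, G (c t),
         forall t : R, derivable c t 1,
         c 0 = 1%:M
       & 'D_1 c 0 = X]].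

Definition ad (R : realType) (n : nat) (X Y : 'M[R]_n) : 'M[R]_n :=
  X *m Y - Y *m X.

(* Only the values of s on g matter; s is unconstrained outside g. *)
Definition involutive_automorphism (R : realType) (n : nat)
    (g : set 'M[R]_n) (s : 'M[R]_n -> 'M[R]_n) : Prop :=
  [/\ forall X, g X -> g (s X),
      forall (a : R) X Y, g X -> g Y -> s (a *: X + Y) = a *: s X + s Y,
      forall X Y, g X -> g Y -> s (ad X Y) = ad (s X) (s Y)
    & forall X, g X -> s (s X) = X].

Definition eigenspace_in (R : realType) (n : nat) (g : set 'M[R]_n)
    (s : 'M[R]_n -> 'M[R]_n) (a : R) : set 'M[R]_n :=
  [set X | g X /\ s X = a *: X].

Definition ad_nilpotent (R : realType) (n : nat) (g : set 'M[R]_n)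
    (E : 'M[R]_n) : Prop :=
  exists k : nat, forall X, g X -> iter k (ad E) X = 0.

(* Main.v *)
Require Import Defs.
From HB Require Import structures.
From mathcomp Require Import all_boot all_order all_algebra ring.
From mathcomp Require Import all_classical all_reals all_analysis.
Import Order.TTheory GRing.Theory Num.Theory.
Import numFieldNormedType.Exports.
Local Open Scope classical_set_scope.
Local Open Scope ring_scope.

Set Implicit Arguments.
Unset Strict Implicit.
Unset Printing Implicit Defensive.

(* The curves in SO(p, q) produced by the Cayley transform show that g is the
   space of all J-skew matrices and h the space of those that kill v.  The
   wedges v /\ w with w orthogonal to v span a complement of h; the map
   w |-> sigma (v /\ w) + v /\ w takes its values in h, and since sigma respects
   the brackets [v /\ w, v /\ u] it gives a trilinear form symmetric in two
   arguments and antisymmetric in two, so it vanishes.  Hence E = v /\ w with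
   w = E v.  For u orthogonal to v and w, ad(E)^2 multiplies v /\ u by -<w, w>,
   so nilpotency forces <w, w> = 0, and then E^3 = 0 and E^2 X E = E X E^2 for
   every skew X, which gives ad(E)^3 = 0. *)

(** * Skew matrices and wedges for a nondegenerate symmetric form $\langle x,y\rangle=x^TJy$ *)

Section Skew.
Context (R : realType) (n : nat) (J : 'M[R]_n).
Hypothesis J_sym : J^T = J.
Hypothesis J_unit : J \in unitmx.

Definition form (x y : 'cV[R]_n) : R := (x^T *m J *m y) 0 0.
(** The image of $x\wedge y$ under the standard map from $\Lambda^2V$ to the skew matrices. *)
Definition wedge (x y : 'cV[R]_n) : 'M[R]_n := y *m (x^T *m J) - x *m (y^T *m J).
(** The equation $g^TJg=J$ linearized at the identity. *)
Definition skew (X : 'M[R]_n) : Prop := X^T *m J + J *m X = 0.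

Lemma formC x y : form x y = form y x.
Proof.
by rewrite /form -[in RHS](trmxK (y^T *m J *m x)) [RHS]mxE !trmx_mul J_sym trmxK mulmxA.
Qed.

Lemma formDl x y z : form (x + y) z = form x z + form y z.
Proof. by rewrite /form raddfD/= !mulmxDl mxE. Qed.

Lemma formZl a x y : form (a *: x) y = a * form x y.
Proof. by rewrite /form linearZ/= -!scalemxAl mxE. Qed.

Lemma formDr x y z : form x (y + z) = form x y + form x z.
Proof. by rewrite !(formC x) formDl. Qed.

Lemma formZr a x y : form x (a *: y) = a * form x y.
Proof. by rewrite !(formC x) formZl. Qed.

Lemma formNl x y : form (- x) y = - form x y.
Proof. by rewrite -scaleN1r formZl mulN1r. Qed.

Lemma formNr x y : form x (- y) = - form x y.
Proof. by rewrite !(formC x) formNl. Qed.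

Lemma form0l x : form 0 x = 0.
Proof. by rewrite -(scale0r 0) formZl mul0r. Qed.

Lemma form0r x : form x 0 = 0.
Proof. by rewrite formC form0l. Qed.

Definition formE := (formDl, formDr, formNl, formNr, formZl, formZr, form0l, form0r).

Lemma form_eq0 x : (forall y, form x y = 0) -> x = 0.
Proof.
move=> x0; apply: trmx_inj; rewrite trmx0; apply: (can_inj (mulmxK J_unit)).
rewrite mul0mx; apply/rowP => j.
by have := x0 (delta_mx j 0); rewrite /form -colE !mxE.
Qed.

Lemma mulmx_form m (z : 'cV[R]_m) x y : z *m (x^T *m J) *m y = form x y *: z.
Proof. by rewrite -mulmxA [_ *m y]mx11_scalar mul_mx_scalar. Qed.

Lemma wedgeE x y z : wedge x y *m z = form x z *: y - form y z *: x.
Proof. by rewrite mulmxBl !mulmx_form. Qed.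

Lemma eq_mulmx (A B : 'M[R]_n) : (forall x : 'cV[R]_n, A *m x = B *m x) -> A = B.
Proof.
move=> AB; apply/matrixP => i j; have := AB (delta_mx j 0).
by rewrite -!colE => /colP/(_ i); rewrite !mxE.
Qed.

Lemma form_skewP X :
  skew X <-> (forall x y, form (X *m x) y = - form x (X *m y)).
Proof.
have E x y : form (X *m x) y + form x (X *m y) = (x^T *m (X^T *m J + J *m X) *m y) 0 0.
  by rewrite /form mulmxDr mulmxDl [RHS]mxE trmx_mul !mulmxA.
split=> [X0 x y|sX]; first by apply/eqP; rewrite -addr_eq0 E X0 mulmx0 mul0mx mxE.
apply/matrixP => i j; rewrite [RHS]mxE.
have := E (delta_mx i 0) (delta_mx j 0).
by rewrite sX addNr trmx_delta -rowE -colE [RHS]mxE [RHS]mxE => ->.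
Qed.

Lemma wedge_skew x y : skew (wedge x y).
Proof.
apply/form_skewP => z t; rewrite !wedgeE !formE (formC x z) (formC y z); ring.
Qed.

Lemma skewB X Y : skew X -> skew Y -> skew (X - Y).
Proof.
rewrite /skew raddfB/= mulmxBl mulmxBr addrACA => -> sY.
by rewrite add0r -opprD [_ + _]sY oppr0.
Qed.

Lemma skewD X Y : skew X -> skew Y -> skew (X + Y).
Proof.
rewrite /skew raddfD/= mulmxDl mulmxDr addrACA => -> sY.
by rewrite add0r.
Qed.

Lemma skew_ad X Y : skew X -> skew Y -> skew (ad X Y).
Proof.
move=> /form_skewP sX /form_skewP sY; apply/form_skewP => x y.
by rewrite !mulmxBl -!mulmxA !formE sX sY sY sX !opprK opprB addrC.
Qed.

Lemma adE X Y (x : 'cV[R]_n) : ad X Y *m x = X *m (Y *m x) - Y *m (X *m x).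
Proof. by rewrite mulmxBl -!mulmxA. Qed.

(** Skew matrices act on $\Lambda^2V$ as derivations; skewness moves [X] across the form in the
    terms of [wedge x y *m X]. *)
Lemma ad_wedge X x y : skew X ->
  ad X (wedge x y) = wedge (X *m x) y + wedge x (X *m y).
Proof.
move=> /form_skewP sX; apply: eq_mulmx => z.
rewrite adE [RHS]mulmxDl !wedgeE mulmxBr -!scalemxAr !sX !scaleNr.
by rewrite opprB opprK addrACA [RHS]addrC; congr (_ + _); rewrite addrC.
Qed.

(** * An involution of the skew matrices whose fixed points are those killing [v] *)

Section Involution.
Variable v : 'cV[R]_n.
Hypothesis v1 : form v v = 1.

Lemma wedge_base w : form v w = 0 -> wedge v w *m v = w.
Proof. by move=> vw; rewrite wedgeE v1 formC vw scale1r scale0r subr0. Qed.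

(** Since [form v v = 1], the space splits as $\mathbb Rv\oplus v^\perp$. *)
Lemma orth_ext (A : 'M[R]_n) : A *m v = 0 ->
  (forall x, form v x = 0 -> A *m x = 0) -> A = 0.
Proof.
move=> Av A0; apply: eq_mulmx => x; rewrite mul0mx.
rewrite -(subrK (form v x *: v) x) mulmxDr -scalemxAr Av scaler0 addr0 A0//.
by rewrite !formE v1 mulr1 subrr.
Qed.

(* The trilinear map form (D a *m b) c is symmetric in a, b and antisymmetric
   in b, c, hence zero. *)
Lemma skew_family_eq0 (D : 'cV[R]_n -> 'M[R]_n) :
  (forall w, form v w = 0 -> skew (D w)) ->
  (forall w, form v w = 0 -> D w *m v = 0) ->
  (forall w u, form v w = 0 -> form v u = 0 -> D w *m u = D u *m w) ->
  forall w, form v w = 0 -> D w = 0.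
Proof.
move=> sD Dv Dsym.
have T a b c : form v a = 0 -> form v b = 0 -> form v c = 0 ->
    form (D a *m b) c = - form (D c *m a) b.
  move=> a0 b0 c0.
  by rewrite ((form_skewP _).1 (sD _ a0)) formC Dsym.
have T0 a b c : form v a = 0 -> form v b = 0 -> form v c = 0 ->
    form (D a *m b) c = 0.
  (* [T] permutes the arguments cyclically at the cost of a sign, so three uses show that the value
     equals its own opposite. *)
  move=> a0 b0 c0; apply/eqP; rewrite -eqNr; apply/eqP.
  by rewrite [RHS]T// [in RHS]T// opprK [RHS]T.
move=> w w0; apply: orth_ext => [|u u0]; first exact: Dv.
apply: form_eq0 => z.
rewrite -(subrK (form v z *: v) z) formDr T0 ?add0r//; last first.
  by rewrite !formE v1 mulr1 subrr.
by rewrite formZr ((form_skewP _).1 (sD _ w0)) Dv// formE oppr0 mulr0.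
Qed.

Variable s : 'M[R]_n -> 'M[R]_n.
Hypothesis s_skew : forall X, skew X -> skew (s X).
Hypothesis s_lin : forall a X Y, skew X -> skew Y -> s (a *: X + Y) = a *: s X + s Y.
Hypothesis s_ad : forall X Y, skew X -> skew Y -> s (ad X Y) = ad (s X) (s Y).
Hypothesis sK : forall X, skew X -> s (s X) = X.
Hypothesis s_fix : forall X, skew X -> s X = X <-> X *m v = 0.

(** The sum [D w] is fixed by [s], hence kills [v]. The symmetry [D w *m u = D u *m w] comes from a
    bracket of two wedges that is itself fixed by [s]. *)
Lemma involution_wedge w : form v w = 0 -> s (wedge v w) = - wedge v w.
Proof.
pose D w := s (wedge v w) + wedge v w.
have sE u : s (wedge v u) = D u - wedge v u by rewrite addrK.
have sD u : skew (D u) by apply: skewD; [apply: s_skew|]; exact: wedge_skew.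
have Dv u : D u *m v = 0.
  apply/s_fix => //.
  rewrite /D -[X in X + _]scale1r s_lin; do ?[exact/s_skew/wedge_skew|exact: wedge_skew].
  by rewrite !scale1r sK ?(addrC (wedge v u))//; exact: wedge_skew.
move=> w0; apply/eqP; rewrite -addr_eq0; apply/eqP.
apply: (@skew_family_eq0 D _ _ _ w w0) => // {w0}w u w0 u0.
(* Both products send [v] to $-\langle w,u\rangle v$, so the bracket kills [v] and is fixed by
   [s]. *)
have adv : ad (wedge v w) (wedge v u) *m v = 0.
  rewrite adE !wedge_base// !wedgeE w0 u0 !scale0r !sub0r (formC u).
  exact: subrr.
have := s_ad (wedge_skew v w) (wedge_skew v u).
rewrite ((s_fix (skew_ad (wedge_skew v w) (wedge_skew v u))).2 adv).
(* At [v], where [s (wedge v u)] takes the value [- u], the bracket identity leaves only the two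
   terms in [D]. *)
move/(congr1 (mulmx^~ v)); rewrite adv adE !sE.
rewrite ![(_ - wedge _ _) *m v]mulmxBl !Dv !wedge_base// !sub0r !mulmxN !(mulmxBl (D _)).
rewrite !wedgeE w0 u0 !scale0r !sub0r !opprK (formC u).
move=> /eqP; rewrite eq_sym addrC opprD addrACA subrr addr0 subr_eq0.
by move=> /eqP.
Qed.

(** The difference of [E] and [wedge v (E *m v)] kills [v], so [s] fixes it; by [involution_wedge],
    [s] also negates it. Hence it vanishes. *)
Lemma antifixed_wedge E : skew E -> s E = - E ->
  form v (E *m v) = 0 /\ E = wedge v (E *m v).
Proof.
move=> sE sEN; have v0 : form v (E *m v) = 0.
  by apply/eqP; rewrite -eqNr -((form_skewP _).1 sE) formC.
split=> //; set P := wedge v _.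
have sP : skew P := wedge_skew _ _.
have sEP : s (E - P) = - (E - P).
  have <- : (-1) *: P + E = E - P by rewrite scaleN1r addrC.
  by rewrite s_lin// involution_wedge// sEN !scaleN1r opprK opprD opprK.
have : s (E - P) = E - P.
  by apply/s_fix; [exact: skewB|rewrite mulmxBl wedge_base// subrr].
rewrite sEP => /eqP; rewrite eq_sym -addr_eq0 -mulr2n -scaler_nat scaler_eq0.
by rewrite pnatr_eq0/= subr_eq0 => /eqP.
Qed.

End Involution.

(** * Nilpotency of $\operatorname{ad}(v\wedge w)$ *)

Lemma ad_wedge_sqnorm_eq0 v w k : form v v = 1 -> form v w = 0 -> (2 < n)%N ->
  (forall X, skew X -> iter k (ad (wedge v w)) X = 0) -> form w w = 0.
Proof.
move=> v1 vw n2 nil; set E := wedge v w.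
have sE : skew E := wedge_skew _ _.
have [u u0 [vu wu]] : exists2 u, u != 0 & form v u = 0 /\ form w u = 0.
  (* A row in the left kernel of this two-column matrix is the transpose of a vector orthogonal to
     [v] and [w]; it exists because the rank is at most 2 < n. *)
  pose M := row_mx (J *m v) (J *m w).
  have kM : kermx M != 0.
    rewrite -mxrank_eq0 mxrank_ker -lt0n subn_gt0.
    exact: leq_ltn_trans (rank_leq_col _) n2.
  have /rowV0Pn[r /sub_kermxP + r0] := kM.
  rewrite mul_mx_row -row_mx0 => /eq_row_mx[rv rw].
  exists r^T; first by rewrite -(inj_eq trmx_inj) trmxK trmx0.
  by rewrite !(formC _ r^T) /form trmxK -!mulmxA rv rw !mxE.
(* Here [E] kills [u], while $Ev=w$ and $Ew=-\langle w,w\rangle v$, so $v\wedge u\mapsto w\wedge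
   u\mapsto-\langle w,w\rangle\,v\wedge u$. *)
have adE2 : ad E (ad E (wedge v u)) = - form w w *: wedge v u.
  have Eu : E *m u = 0 by rewrite wedgeE vu wu !scale0r subrr.
  have w0 x : wedge x 0 = 0 by rewrite /wedge mul0mx trmx0 mul0mx mulmx0 subrr.
  rewrite ad_wedge// Eu w0 addr0 wedge_base// ad_wedge// Eu w0 addr0.
  rewrite wedgeE vw scale0r sub0r.
  rewrite /wedge linearN/= linearZ/= !mulNmx mulmxN -!scalemxAl -scalemxAr.
  by rewrite -scaleNr -scaleNr -scalerBr.
have itE m : iter m (fun X => ad E (ad E X)) (wedge v u) =
    (- form w w) ^+ m *: wedge v u.
  elim: m => [|m IH]; first by rewrite expr0 scale1r.
  rewrite iterS IH /ad; do 2![rewrite -!scalemxAr -!scalemxAl -!scalerBr].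
  by rewrite -/(ad E _) -/(ad E _) adE2 scalerA -exprSr.
have ad0 m : iter m (ad E) 0 = 0.
  by elim: m => //= m ->; rewrite /ad mulmx0 mul0mx subrr.
have : iter k (fun X => ad E (ad E X)) (wedge v u) = 0.
  have -> : iter k (fun X => ad E (ad E X)) (wedge v u) =
      iter (k + k) (ad E) (wedge v u).
    by elim: (k) => //= m ->; rewrite addnS.
  by rewrite iterD (nil _ (wedge_skew _ _)) ad0.
(* Evaluation at [v] gives $(-\langle w,w\rangle)^k u=0$ with $u\ne0$. *)
rewrite itE => /(congr1 (mulmx^~ v)); rewrite mul0mx -scalemxAl wedge_base//.
by move/eqP; rewrite scaler_eq0 (negPf u0) orbF expf_eq0 oppr_eq0 => /andP[_ /eqP].
Qed.

(** In $\operatorname{ad}(E)^3X=E^3X-3E^2XE+3EXE^2-XE^3$ the outer terms vanish and the middle ones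
    cancel. *)
Lemma ad3_wedge v w X : form v v = 1 -> form v w = 0 -> form w w = 0 -> skew X ->
  iter 3 (ad (wedge v w)) X = 0.
Proof.
move=> v1 vw ww sX; set E := wedge v w.
have sE : skew E := wedge_skew _ _.
have Ew : E *m w = 0 by rewrite wedgeE vw ww !scale0r subrr.
have EE x : E *m (E *m x) = - form w x *: w.
  rewrite wedgeE !wedgeE !formE v1 vw ww (formC w v) vw.
  by rewrite !mulr0 mulr1 !subr0 !scale0r sub0r subr0.
have E3 (x : 'cV_n) : E *m (E *m (E *m x)) = 0.
  by rewrite EE -((form_skewP _).1 sE) Ew form0l scale0r.
(* Both sides equal $\langle w,x\rangle\langle w,Xv\rangle w$, because $\langle w,Xw\rangle=0$. *)
have EXE (x : 'cV_n) : E *m (E *m (X *m (E *m x))) = E *m (X *m (E *m (E *m x))).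
  rewrite !EE -!scalemxAr.
  have Xww : form w (X *m w) = 0.
    by apply/eqP; rewrite -eqNr -((form_skewP _).1 sX) formC.
  rewrite !wedgeE mulmxBr -!scalemxAr !formE Xww scale0r subr0 scalerA.
  rewrite -[form v (X *m w)]opprK -((form_skewP _).1 sX) (formC (X *m v)).
  by rewrite mulr0 sub0r opprK mulrNN.
apply: eq_mulmx => x; rewrite /= !adE !mulmxBr !E3 !EXE.
by rewrite mulmx0 mul0mx !subrr !subr0 !sub0r opprK addNr.
Qed.
End Skew.

(** * Calculus of matrix-valued curves *)

Lemma is_derive_mulmx (R : realType) (m n p : nat) (A : R -> 'M[R]_(m, n))
    (B : R -> 'M[R]_(n, p)) (t : R) :
  derivable A t 1 -> derivable B t 1 ->
  is_derive t 1 (fun x => A x *m B x) ('D_1 A t *m B t + A t *m 'D_1 B t).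
Proof.
move=> dA dB.
have dAi := (derivable_mxP _ _ _).1 dA.
have dBi := (derivable_mxP _ _ _).1 dB.
have dAB i j : is_derive t 1 (fun x => (A x *m B x) i j)
    (('D_1 A t *m B t + A t *m 'D_1 B t) i j).
  rewrite (_ : (fun x => _) =
      \sum_(k < n) ((fun x => A x i k) * (fun x => B x k j))); last first.
    by apply/funext => x; rewrite mxE fct_sumE.
  apply: is_derive_eq.
    apply: is_derive_sum => k; apply: is_deriveM.
    - exact: derivableP (dAi i k).
    - exact: derivableP (dBi k j).
  rewrite !derive_mx// !mxE -big_split/=; apply: eq_bigr => k _.
  by rewrite !mxE addrC; congr (_ + _); rewrite mulrC.
have dM : derivable (fun x => A x *m B x) t 1.
  by apply/derivable_mxP => i j; case: (dAB i j).
apply: DeriveDef => //; rewrite derive_mx//; apply/matrixP => i j.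
by rewrite mxE; case: (dAB i j).
Qed.

Lemma derivable_continuous_mx (R : realType) (m n : nat) (c : R -> 'M[R]_(m, n)) :
  (forall t, derivable c t 1) -> continuous c.
Proof.
by move=> dc t; apply: differentiable_continuous; apply/derivable1_diffP/dc.
Qed.

(** The image of the real line is a connected set containing the identity. *)
Lemma curve_in_SO (R : realType) (p q : nat) (c : R -> 'M[R]_(p + q)) :
  (forall t, special_pseudo_orthogonal R p q (c t)) -> continuous c ->
  c 0 = 1%:M -> forall t, SO R p q (c t).
Proof.
move=> cG cc c0 t.
apply: (@connected_component_max _ _ (c @` setT)).
- by exists 0.
- by move=> _ [s _ <-].
- apply: connected_continuous_connected.
    by apply/connected_intervalP => ? ? ? ? ?.
  by apply: continuous_subspaceT.
- by exists t.
Qed.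

Lemma is_derive_scalemx (R : realType) (m n : nat) (s : R -> R) (ds t : R)
    (X : 'M[R]_(m, n)) :
  is_derive t 1 s ds -> is_derive t 1 (fun x => s x *: X) (ds *: X).
Proof.
move=> dsP.
have dX i j : is_derive t 1 (fun x => (s x *: X) i j) ((ds *: X) i j).
  rewrite (_ : (fun x => _) = s * cst (X i j)); last first.
    by apply/funext => x; rewrite mxE.
  apply: is_derive_eq.
  by rewrite scaler0 add0r mxE mulrC.
have dM : derivable (fun x => s x *: X) t 1.
  by apply/derivable_mxP => i j; case: (dX i j).
apply: DeriveDef => //; rewrite derive_mx//; apply/matrixP => i j.
by rewrite mxE; case: (dX i j).
Qed.

(** * Cayley transform *)

Definition cayley (F : comUnitRingType) (n : nat) (X : 'M[F]_n) : 'M[F]_n :=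
  invmx (1%:M - X) *m (1%:M + X).

(** The inverse is the adjugate over the determinant; both are formed over the polynomial ring and
    then evaluated at [s]. *)
Lemma cayleyZ_rational (F : fieldType) (n : nat) (X : 'M[F]_n) :
  exists (d : {poly F}) (P : 'M[{poly F}]_n),
    forall s, d.[s] = \det (1%:M - s *: X) /\
      (d.[s] != 0 -> cayley (s *: X) = \matrix_(i, j) ((P i j).[s] / d.[s])).
Proof.
pose Y : 'M[{poly F}]_n := map_mx (fun a => a *: 'X) X.
set d := \det (1%:M - Y).
exists d, (\adj (1%:M - Y) *m (1%:M + Y)) => s.
have YE : map_mx (horner_eval s) Y = s *: X.
  by apply/matrixP => i j; rewrite !mxE /horner_eval hornerZ hornerX mulrC.
have dE : d.[s] = \det (1%:M - s *: X).
  by rewrite -[LHS]/(horner_eval s _) -det_map_mx map_mxB map_mx1 YE.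
split=> // d0; apply/matrixP => i j; rewrite [RHS]mxE.
transitivity (map_mx (horner_eval s) (\adj (1%:M - Y) *m (1%:M + Y)) i j / d.[s]);
  last by rewrite mxE.
rewrite map_mxM map_mx_adj map_mxB map_mxD map_mx1 YE /cayley /invmx.
by rewrite unitmxE unitfE -dE d0 -scalemxAl mxE mulrC.
Qed.

(** Differentiability follows from rationality in the parameter, once the parameter is confined to
    an interval where the denominator has no zero. *)
Lemma cayley_curve (R : realType) (n : nat) (X : 'M[R]_n) :
  exists c : R -> 'M[R]_n,
    [/\ forall t, derivable c t 1, c 0 = 1%:M, 'D_1 c 0 = X
      & forall t, exists2 s, 1%:M - s *: X \in unitmx & c t = cayley (s *: X)].
Proof.
have [d [P dP]] := cayleyZ_rational X.
have d0 : d.[0] = 1 by rewrite (dP 0).1 scale0r subr0 det1.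
have [e e0 de] : exists2 e : R, 0 < e & forall s, `|s| <= e -> d.[s] != 0.
  have /cvgrPdist_lt/(_ 1 ltr01) := @continuous_horner R d 0.
  move=> [e /= e0 He]; exists (e / 2); first by rewrite divr_gt0.
  move=> s se; have : ball_ Num.norm 0 e s.
    by rewrite /ball_/= sub0r normrN (le_lt_trans se)// ltr_pdivrMr// ltr_pMr// ltr1n.
  by move=> /He; rewrite d0; apply: contraTneq => ->; rewrite subr0 normr1 ltxx.
(* The sine keeps the parameter in [-e, e], where 1 - s X is invertible. *)
pose s (t : R) := e * sin ((2 * e)^-1 * t).
(* The slope 1/2 at 0 offsets the derivative $2X$ of [cayley (s *: X)] at [s = 0]. *)
have ds (t : R) : is_derive t 1 s (2^-1 * cos ((2 * e)^-1 * t)).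
  rewrite (_ : s = cst e * (sin \o (cst (2 * e)^-1 * id))); last by apply/funext.
  apply: is_derive_eq.
  rewrite /= !scaler0 addr0 addr0 /GRing.scale/= mulr1 fctE.
  by rewrite /cst/=; field; rewrite gt_eqF.
have s0 : s 0 = 0 by rewrite /s mulr0 sin0 mulr0.
have sn0 t : d.[s t] != 0.
  apply: de; rewrite normrM gtr0_norm// ler_piMr ?(ltW e0)//.
  by rewrite ler_norml sin_le1 sin_geN1.
have su t : 1%:M - s t *: X \in unitmx by rewrite unitmxE unitfE -(dP _).1.
pose c t := cayley (s t *: X).
have dc t : derivable c t 1.
  apply/derivable_mxP => i j.
  rewrite (_ : (fun x => _) = (horner (P i j) \o s) *
      (fun y => ((horner d \o s) y)^-1)); last first.
    by apply/funext => x; rewrite /c (dP (s x)).2// mxE.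
  have dh (p : {poly R}) : derivable (horner p \o s) t 1.
    have /derivableP dp : derivable (horner p) (s t) 1 by exact: derivable_horner.
    by case: (is_derive1_comp dp (ds t)).
  by apply: derivableM => //; apply: (@derivableV _ _ (horner d \o s)) => //; exact: sn0.
have c0 : c 0 = 1%:M by rewrite /c s0 scale0r /cayley subr0 addr0 invmx1 mulmx1.
exists c; split => //; last by move=> t; exists (s t).
have ds0 : is_derive (0 : R) 1 s 2^-1.
  by have := ds 0; rewrite mulr0 cos0 mulr1.
have dX := is_derive_scalemx X ds0.
have dB : is_derive (0 : R) 1 (cst 1%:M + (fun t => s t *: X)) (2^-1 *: X).
  by apply: is_derive_eq; rewrite add0r.
have dA : is_derive (0 : R) 1 (cst 1%:M - (fun t => s t *: X)) (- (2^-1 *: X)).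
  by apply: is_derive_eq; rewrite sub0r.
(* Differentiating $(1-sX)c=1+sX$ at 0 gives $-X/2+c'(0)=X/2$. *)
have := is_derive_mulmx (@ex_derive _ _ _ _ _ _ _ dA) (dc 0).
rewrite (_ : (fun x => (cst 1%:M - (fun t => s t *: X)) x *m c x) =
    cst 1%:M + (fun t => s t *: X)); last first.
  by apply/funext => t; rewrite /c /cayley !fctE /= mulmxA mulmxV// mul1mx.
move=> [_]; rewrite !derive_val c0 mulmx1 !fctE/= s0 scale0r subr0 mul1mx.
move=> /eqP; rewrite addrC eq_sym subr_eq => /eqP ->.
by rewrite -scalerDl -[2^-1]mul1r -splitr scale1r.
Qed.

(** With $A=1-X$ and $B=1+X$, skewness gives $A^TJ=JB$ and $B^TJ=JA$, and $A$, $B$ commute. *)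
Lemma cayley_isometry (F : fieldType) (n : nat) (J X : 'M[F]_n) :
  J \in unitmx -> X^T *m J + J *m X = 0 -> 1%:M - X \in unitmx ->
  (cayley X)^T *m J *m cayley X = J /\ \det (cayley X) = 1.
Proof.
move=> uJ XJ uA; set A := 1%:M - X; set B := 1%:M + X; set c := cayley X.
have XJ' : X^T *m J = - (J *m X) by apply/eqP; rewrite -addr_eq0 XJ.
have AJ : A^T *m J = J *m B.
  by rewrite raddfB/= trmx1 mulmxBl mulmxDr mul1mx mulmx1 XJ' opprK.
have BJ : B^T *m J = J *m A.
  by rewrite raddfD/= trmx1 mulmxDl mulmxBr mul1mx mulmx1 XJ'.
have AB : A *m B = B *m A.
  by rewrite mulmxBl [RHS]mulmxDl !mul1mx mulmxDr mulmxBr !mulmx1 opprD addrACA.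
have Ac : A *m c = B by rewrite mulmxA mulmxV// mul1mx.
have cA : c *m A = B by rewrite /c /cayley -/A -/B -mulmxA -AB mulKmx.
have uAT : A^T \in unitmx by rewrite unitmx_tr.
split.
  (* Multiplying by $A^T$ and $A$ removes the inverse and leaves $B^TJB=A^TJA$. *)
  apply: (can_inj (mulKmx uAT)); apply: (can_inj (mulmxK uA)).
  have conj (C D : 'M[F]_n) :
      D^T *m (C^T *m J *m C) *m D = (C *m D)^T *m J *m (C *m D).
    by rewrite trmx_mul !mulmxA.
  by rewrite conj cA BJ -mulmxA AB mulmxA AJ.
have dA : \det A \is a GRing.unit by rewrite -unitmxE.
have dJ : \det J \is a GRing.unit by rewrite -unitmxE.
(* Here $Ac=B$, and $A^TJ=JB$ forces $\det A=\det B$. *)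
apply: (mulrI dA); rewrite mulr1 -det_mulmx Ac.
by apply: (mulrI dJ); rewrite -det_mulmx -AJ det_mulmx det_tr mulrC.
Qed.

(** * Lie algebras of $SO(p,q)$ and of a stabilizer *)

Lemma is_derive_trmx (R : realType) (m n : nat) (A : R -> 'M[R]_(m, n)) (t : R) :
  derivable A t 1 -> is_derive t 1 (fun x => (A x)^T) ('D_1 A t)^T.
Proof.
move=> dA; have dAi := (derivable_mxP _ _ _).1 dA.
have trE i j : (fun x => (A x)^T i j) = fun x => A x j i.
  by apply/funext => x; rewrite mxE.
have dM : derivable (fun x => (A x)^T) t 1.
  by apply/derivable_mxP => i j; rewrite trE.
apply: DeriveDef => //; rewrite !derive_mx//; apply/matrixP => i j.
by rewrite !mxE trE.
Qed.

Lemma signature_mx_sym (R : realType) (p q : nat) :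
  (signature_mx R p q)^T = signature_mx R p q.
Proof. by rewrite /signature_mx tr_block_mx !trmx0 raddfN/= !trmx1. Qed.

Lemma signature_mx_unit (R : realType) (p q : nat) :
  signature_mx R p q \in unitmx.
Proof.
suff /mulmx1_unit[] : signature_mx R p q *m signature_mx R p q = 1%:M by [].
rewrite mulmx_block !mulmx0 !mul0mx !mul1mx mulNmx mulmxN mul1mx opprK !addr0 !add0r.
by rewrite -scalar_mx_block.
Qed.

Lemma lie_algebra_mono (R : realType) (n : nat) (G G' : set 'M[R]_n) :
  G `<=` G' -> lie_algebra G `<=` lie_algebra G'.
Proof. by move=> GG' X [c [Gc dc c0 cX]]; exists c; split=> // t; exact: GG'. Qed.

(** Differentiate $c^TJc=J$ at 0. *)
Lemma lie_algebra_SO_skew (R : realType) (p q : nat) (X : 'M[R]_(p + q)) :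
  lie_algebra (SO R p q) X -> skew (signature_mx R p q) X.
Proof.
move=> [c [Gc dc c0 cX]]; set J := signature_mx R p q.
have dcT := is_derive_trmx (dc 0).
have dJ := is_derive_mulmx (@ex_derive _ _ _ _ _ _ _ dcT) (derivable_cst J (0 : R) 1).
have [_] := is_derive_mulmx (@ex_derive _ _ _ _ _ _ _ dJ) (dc 0).
rewrite (_ : (fun x => _ *m c x) = cst J); last first.
  by apply/funext => t; case: (connected_component_sub (Gc t)).
by rewrite !derive_val mulmx0 addr0 cX c0 trmx1 mulmx1 mul1mx => /esym.
Qed.

Lemma lie_algebra_stabilizer (R : realType) (n : nat) (G : set 'M[R]_n)
    (v : 'cV[R]_n) (X : 'M[R]_n) :
  lie_algebra (stabilizer G v) X -> X *m v = 0.
Proof.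
move=> [c [Gc dc c0 cX]].
have [_] := is_derive_mulmx (dc 0) (derivable_cst v (0 : R) 1).
rewrite (_ : (fun x => c x *m _) = cst v); last first.
  by apply/funext => t; case: (Gc t).
by rewrite !derive_cst cX mulmx0 addr0 => <-.
Qed.

(** The Cayley curve also fixes every vector that [X] kills, so the same curve serves $\mathfrak g$
    and $\mathfrak h$. *)
Lemma skew_curve (R : realType) (p q : nat) (X : 'M[R]_(p + q)) :
  skew (signature_mx R p q) X ->
  exists c : R -> 'M[R]_(p + q),
    [/\ forall t, SO R p q (c t), forall t, derivable c t 1, c 0 = 1%:M,
        'D_1 c 0 = X & forall v : 'cV[R]_(p + q), X *m v = 0 -> forall t, c t *m v = v].
Proof.
move=> sX; have [c [dc c0 cX cE]] := cayley_curve X.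
have cP t : special_pseudo_orthogonal R p q (c t).
  have [s us ->] := cE t; apply: cayley_isometry us.
    exact: signature_mx_unit.
  by rewrite linearZ/= -scalemxAl -scalemxAr -scalerDr sX scaler0.
exists c; split=> // [t|v Xv t].
  exact: curve_in_SO cP (derivable_continuous_mx dc) c0 t.
have [s us ->] := cE t.
(* Both factors $1\mp sX$ of the Cayley transform fix [v]. *)
have Av : (1%:M - s *: X) *m v = v.
  by rewrite mulmxBl mul1mx -scalemxAl Xv scaler0 subr0.
rewrite -mulmxA mulmxDl mul1mx -scalemxAl Xv scaler0 addr0.
by rewrite -[in LHS]Av mulKmx.
Qed.

Lemma lie_algebra_SOE (R : realType) (p q : nat) :
  lie_algebra (SO R p q) = [set X | skew (signature_mx R p q) X].
Proof.
apply/seteqP; split=> X; first exact: lie_algebra_SO_skew.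
by move=> /skew_curve[c [? ? ? ? _]]; exists c.
Qed.

Lemma lie_algebra_stabilizer_SOE (R : realType) (p q : nat) (v : 'cV[R]_(p + q)) :
  lie_algebra (stabilizer (SO R p q) v) =
  [set X | skew (signature_mx R p q) X /\ X *m v = 0].
Proof.
apply/seteqP; split=> X /=.
  move=> hX; split; last exact: lie_algebra_stabilizer hX.
  by apply: lie_algebra_SO_skew; apply: lie_algebra_mono hX => Y [].
move=> [/skew_curve[c [? ? ? ? cv]] Xv]; exists c; split=> // t.
by split=> //; exact: cv.
Qed.

(** * Application to signature $(2,l-1)$ *)

Theorem proposition47 (R : realType) (l : nat) (hl : (3 <= l)%N)
    (v : 'cV[R]_(2 + (l - 1))) (hv : pseudo_sqnorm v = 1)
    (G H g h q : set 'M[R]_(2 + (l - 1)))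
    (hG : G = SO R 2 (l - 1))
    (hH : H = stabilizer G v)
    (hg : g = lie_algebra G)
    (hh : h = lie_algebra H)
    (sigma : 'M[R]_(2 + (l - 1)) -> 'M[R]_(2 + (l - 1)))
    (hsigma : involutive_automorphism g sigma)
    (hsigma_fix : eigenspace_in g sigma 1 = h)
    (hq : q = eigenspace_in g sigma (-1))
    (E : 'M[R]_(2 + (l - 1))) (hE : q E) (hnil : ad_nilpotent g E) :
  forall X : 'M[R]_(2 + (l - 1)), g X -> iter 3 (ad E) X = 0.
Proof.
set J := signature_mx R 2 (l - 1).
have Jsym : J^T = J := signature_mx_sym _ _ _.
have Junit : J \in unitmx := signature_mx_unit _ _ _.
have gE : g = [set X | skew J X] by rewrite hg hG lie_algebra_SOE.
have hE' : h = [set X | skew J X /\ X *m v = 0].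
  by rewrite hh hH hG lie_algebra_stabilizer_SOE.
move: hsigma hsigma_fix hE hnil; rewrite hq hE' gE.
move=> [s_skew s_lin s_ad sK] fixE [sE sEN] [k nil].
(* The equality of the $+1$-eigenspace with $\mathfrak h$, read at a single skew matrix. *)
have s_fix Y : skew J Y -> sigma Y = Y <-> Y *m v = 0.
  move=> sY; have := congr1 (fun A : set _ => A Y) fixE.
  rewrite /eigenspace_in /= scale1r => e.
  by split=> [sYE|Yv]; [have [] : skew J Y /\ Y *m v = 0 by rewrite -e
                       |have [] : skew J Y /\ sigma Y = Y by rewrite e].
have [vw Ew] := antifixed_wedge Jsym Junit hv s_skew s_lin s_ad sK s_fix sE
  (etrans sEN (scaleN1r _)).
have n3 : (2 < 2 + (l - 1))%N by rewrite -addn1 leq_add2l subn_gt0 (leq_trans _ hl).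
rewrite Ew in nil |- *; have ww := ad_wedge_sqnorm_eq0 Jsym hv vw n3 nil.
by move=> X sX; exact: (ad3_wedge Jsym hv vw ww sX).
Qed.
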